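(* Let $\Gamma_1,\Gamma_2\subset\mathbb{C}$ be quasilines, and assume that $\Gamma_1$ is an asymptotically conformal quasiline. Let $h\colon\Gamma_1\to\Gamma_2$ be a quasisymmetric homeomorphism. If $h$ is equidistant weakly asymptotically symmetric (EWAS), then $h$ is asymptotically symmetric (AS). Consequently, for such $h$ the conditions EWAS, WAS (weakly asymptotically symmetric), and AS are equivalent.
   Context: Let $X,Y$ be metric spaces with distances written $|x_1-x_2|$; subsets of $\mathbb{C}$ carry the Euclidean metric. An embedding $h\colon X\to Y$ (homeomorphism onto its image) is quasisymmetric if there is a homeomorphism $\eta\colon[0,\infty)\to[0,\infty)$ such that for any three distinct points $a,b,x\in X$ and $t\ge 0$, $\frac{|a-x|}{|b-x|}\le t$ implies $\frac{|h(a)-h(x)|}{|h(b)-h(x)|}\le\eta(t)$. A quasiline is a set $\Gamma\subset\mathbb{C}$ that is the image $f(\mathbb{R})$ of a quasisymmetric embedding $f\colon\mathbb{R}\to\mathbb{C}$ (together with $\infty$ it is a Jordan curve in the Riemann sphere). For $a,b\in\Gamma$, $\Gamma[a,b]$ denotes the bounded subarc of $\Gamma$ joining them. A quasiline $\Gamma$ is asymptotically conformal if $$\omega_\Gamma(r):=\sup_{a,b\in\Gamma,\ 0<|a-b|\le r}\ \max_{w\in\Gamma[a,b]}\left(\frac{|a-w|+|w-b|}{|a-b|}-1\right)\to0\qquad(r\to0).$$ $h$ is asymptotically symmetric (AS) if for every $\varepsilon>0$ and every $t>0$ there exists $\delta>0$ such that for all distinct $a,b,x\in X$ with $\operatorname{diam}\{a,b,x\}\le\delta$: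 $\frac{|a-x|}{|b-x|}\le t$ implies $\frac{|h(a)-h(x)|}{|h(b)-h(x)|}\le(1+\varepsilon)t$. $h$ is weakly asymptotically symmetric (WAS) if this is required only for $t=1$ (for every $\varepsilon>0$). For $r>0$ put $$H_h^{\mathrm{eq}}(r)=\sup\left\{\max\left(\tfrac{|h(a)-h(x)|}{|h(b)-h(x)|},\tfrac{|h(b)-h(x)|}{|h(a)-h(x)|}\right): a,b,x\in X,\ |a-x|=|b-x|,\ 0<\operatorname{diam}\{a,b,x\}\le r\right\}.$$ $h$ is equidistant weakly asymptotically symmetric (EWAS) if $H_h^{\mathrm{eq}}(r)\to1$ as $r\to0$. *)

(* Defs.v *)
(* The complex plane is [Rcomplex R], which carries the R-valued norm
   |x + iy| = sqrt(x^2 + y^2). *)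
From HB Require Import structures.
From mathcomp Require Import all_boot all_order all_algebra.
From mathcomp Require Import all_classical all_reals all_analysis.
From mathcomp Require Import complex.

Set Implicit Arguments.
Unset Strict Implicit.
Unset Printing Implicit Defensive.

Import Order.TTheory GRing.Theory Num.Theory.
Import numFieldNormedType.Exports.

Local Open Scope classical_set_scope.
Local Open Scope ring_scope.

Section Rcomplex_metric.
Variable R : realType.
Local Notation C := (Rcomplex R).
Implicit Types x y z : C.

Let d x y : R := `|y - x|.

Let dxx x : d x x = 0.
Proof. by rewrite /d subrr normr0. Qed.

Let d_eq0 x y : d x y = 0 -> x = y.
Proof. by move/normr0_eq0/eqP; rewrite subr_eq0 => /eqP. Qed.

Let d_sym x y : d x y = d y x.
Proof. exact: distrC. Qed.

Let d_triangle y x z : d x z <= d x y + d y z.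
Proof. by rewrite addrC; exact: ler_distD. Qed.

HB.instance Definition _ := isMetric.Build R C dxx d_eq0 d_sym d_triangle.
HB.instance Definition _ := isPointed.Build C (0 : C).

Let mdist_normE x y : mdist x y = `|y - x|.
Proof. by []. Qed.

HB.instance Definition _ := NormedZmoduleMetric.Build R C mdist_normE.

Let normcZ (l : R) x : `|l *: x| = `|l| * `|x|.
Proof.
case: x => a b; rewrite /Num.norm /= !exprMn -mulrDr sqrtrM ?sqr_ge0//.
by rewrite sqrtr_sqr.
Qed.

HB.instance Definition _ :=
  PseudoMetricNormedZmod_Lmodule_isNormedModule.Build R C normcZ.

End Rcomplex_metric.

(* A map between subspaces is given by an ambient function [f] restricted to
   the subset [A] with the induced metric; values of [f] off [A] are never
   used. *)

Definition homeomorphism {T U : topologicalType} (A : set T) (B : set U)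
    (f : T -> U) : Prop :=
  [/\ set_bij A B f, {within A, continuous f} &
      exists g : U -> T,
        (forall x, A x -> g (f x) = x) /\ {within B, continuous g}].

Definition qs_embedding (R : realType) (X Y : metricType R) (A : set X)
    (h : X -> Y) : Prop :=
  homeomorphism A (h @` A) h /\
  exists eta : R -> R,
    homeomorphism (`[0, +oo[ : set R) (`[0, +oo[ : set R) eta /\
    forall a b x, A a -> A b -> A x -> a != b -> a != x -> b != x ->
    forall t, 0 <= t -> mdist a x / mdist b x <= t ->
      mdist (h a) (h x) / mdist (h b) (h x) <= eta t.

Definition qs_homeomorphism (R : realType) (X Y : metricType R) (A : set X)
    (B : set Y) (h : X -> Y) : Prop :=
  h @` A = B /\ qs_embedding A h.

Definition quasiline (R : realType) (Gamma : set (Rcomplex R)) : Prop :=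
  exists f : R^o -> Rcomplex R, qs_embedding setT f /\ f @` setT = Gamma.

(* All points lying on some simple arc in [Gamma] from [a] to [b]. A quasiline
   is homeomorphic to the line, so for [a != b] there is exactly one such arc;
   being compact it is the bounded one. *)
Definition subarc (R : realType) (X : metricType R) (Gamma : set X)
    (a b : X) : set X :=
  [set w | exists c : R -> X,
     [/\ {within `[0, 1], continuous c}, set_inj `[0, 1] c,
         c 0 = a /\ c 1 = b, c @` `[0, 1] `<=` Gamma & (c @` `[0, 1]) w]].

(* The inner supremum is a maximum, the arc being compact. *)
Definition omega (R : realType) (X : metricType R) (Gamma : set X)
    (r : R) : \bar R :=
  ereal_sup [set ereal_sup
      [set ((mdist p.1 w + mdist w p.2) / mdist p.1 p.2 - 1)%:E
        | w in subarc Gamma p.1 p.2]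
    | p in [set p : X * X |
        [/\ Gamma p.1, Gamma p.2 & 0 < mdist p.1 p.2 <= r]]].

Definition asymptotically_conformal (R : realType)
    (Gamma : set (Rcomplex R)) : Prop :=
  omega Gamma r @[r --> 0^'+] --> 0%:E.

Definition diam (R : realType) (X : metricType R) (A : set X) : \bar R :=
  ereal_sup [set (mdist p.1 p.2)%:E | p in A `*` A].

Definition asymptotically_symmetric_at (R : realType) (X Y : metricType R)
    (A : set X) (h : X -> Y) (t : R) : Prop :=
  forall e : R, 0 < e -> exists2 delta : R, 0 < delta &
    forall a b x, A a -> A b -> A x -> a != b -> a != x -> b != x ->
      (diam [set a; b; x] <= delta%:E)%E -> mdist a x / mdist b x <= t ->
      mdist (h a) (h x) / mdist (h b) (h x) <= (1 + e) * t.

Definition AS (R : realType) (X Y : metricType R) (A : set X)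
    (h : X -> Y) : Prop :=
  forall t : R, 0 < t -> asymptotically_symmetric_at A h t.

Definition WAS (R : realType) (X Y : metricType R) (A : set X)
    (h : X -> Y) : Prop :=
  asymptotically_symmetric_at A h 1.

Definition Heq (R : realType) (X Y : metricType R) (A : set X) (h : X -> Y)
    (r : R) : \bar R :=
  ereal_sup [set u : \bar R | exists a b x : X,
    [/\ A a /\ A b /\ A x, mdist a x = mdist b x,
        (0 < diam [set a; b; x] <= r%:E)%E &
        u = (Num.max (mdist (h a) (h x) / mdist (h b) (h x))
                     (mdist (h b) (h x) / mdist (h a) (h x)))%:E]].

Definition EWAS (R : realType) (X Y : metricType R) (A : set X)
    (h : X -> Y) : Prop :=
  Heq A h r @[r --> 0^'+] --> 1%:E.

(* Main.v *)
(* Blow up [h] at points [x_n] where asymptotic symmetry fails, at the scale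
   [|b_n - x_n|]. Asymptotic conformality makes the rescaled copies of Gamma_1
   converge to a straight line, and quasisymmetry makes the rescaled maps converge,
   along an ultrafilter, to a map [g] from the line to the plane. EWAS turns into
   the exact identity |g(x+d) - g(x)| = |g(x) - g(x-d)|, and quasisymmetry keeps
   [g] injective and unbounded along every arithmetic progression.

   In the plane such a [g] is affine. Fix a step [d] and let [w_k] be the (unit)
   ratio of consecutive differences of [g] along a progression. The identity for
   the steps d, 2d and 3d makes Re w_k 2-periodic and (Im w_k)(Im w_(k+1))
   3-periodic; if the Im w_k do not vanish, then w_k is 6-periodic, so six steps
   act by a fixed rotation, which must be trivial because a rotation would keep
   the progression bounded. If some Im w_k vanishes, pass to the step 2d. Hence
   [g] is affine on a sparse progression; the step being arbitrary, [g] satisfies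
   Jensen's equation. This contradicts the failure of asymptotic symmetry in the
   limit. *)
Require Import Defs.
From mathcomp Require Import all_boot all_order all_algebra.
From mathcomp Require Import all_classical all_reals all_analysis.
From mathcomp Require Import complex ring lra.

Set Implicit Arguments.
Unset Strict Implicit.
Unset Printing Implicit Defensive.

Import Order.TTheory GRing.Theory Num.Theory.
Import numFieldNormedType.Exports.

Local Open Scope classical_set_scope.
Local Open Scope ring_scope.

(* [z * w] is otherwise read in [R[i]], whose norm is complex valued. *)
Local Notation nrm z := (`|(z : Rcomplex _)|).

Local Notation Re := (@complex.Re _).
Local Notation Im := (@complex.Im _).

(** * Equidistant maps from the line to the plane *)

Section Rcomplex_norm.
Variable R : realType.
Implicit Types z w : Rcomplex R.

Lemma Rcomplex_normM z w : nrm (z * w) = nrm z * nrm w :> R.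
Proof. exact: Normc.normcM. Qed.

Lemma Rcomplex_norm1 : nrm 1 = 1 :> R.
Proof. exact: Normc.normc1. Qed.

Lemma Rcomplex_normV z : nrm (z^-1) = (nrm z)^-1 :> R.
Proof.
have [->|z0] := eqVneq z 0; first by rewrite invr0 !normr0 invr0.
have nz0 : nrm z != 0 by rewrite normr_eq0.
by apply: (mulfI nz0); rewrite -Rcomplex_normM !divff // Rcomplex_norm1.
Qed.

Lemma Rcomplex_sqr_norm z : nrm z ^+ 2 = Re z ^+ 2 + Im z ^+ 2 :> R.
Proof. by case: z => a b; rewrite sqr_sqrtr // addr_ge0 ?sqr_ge0. Qed.

Lemma Rcomplex_eq z w : Re z = Re w -> Im z = Im w -> z = w.
Proof. by case: z => a b; case: w => c d /= -> ->. Qed.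

Lemma Rcomplex_ReM z w : Re (z * w) = Re z * Re w - Im z * Im w.
Proof. by case: z w => [a b] [c d]. Qed.

Lemma Rcomplex_ImM z w : Im (z * w) = Re z * Im w + Im z * Re w.
Proof. by case: z w => [a b] [c d]. Qed.

Lemma Rcomplex_ReD z w : Re (z + w) = Re z + Re w.
Proof. by case: z w => [a b] [c d]. Qed.

Lemma Rcomplex_ImD z w : Im (z + w) = Im z + Im w.
Proof. by case: z w => [a b] [c d]. Qed.

(** [1 + z] is two unit steps with turn [z]; its length thus determines [Re z]. *)
Lemma Rcomplex_sqr_norm_1D z : nrm z = 1 :> R ->
  nrm (1 + z) ^+ 2 = 2 + 2 * Re z :> R.
Proof.
move=> z1; have := Rcomplex_sqr_norm z.
rewrite z1 Rcomplex_sqr_norm Rcomplex_ReD Rcomplex_ImD.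
rewrite [Re 1]/(1 : R) [Im 1]/(0 : R).
move: (Re z) (Im z) => a b; rewrite expr1n => h.
rewrite (_ : (1 + a) ^+ 2 + (0 + b) ^+ 2 = 1 + 2 * a + (a ^+ 2 + b ^+ 2)).
  by rewrite -h; ring.
by ring.
Qed.

Lemma Rcomplex_sqr_norm_1DDM z w : nrm z = 1 :> R -> nrm w = 1 :> R ->
  nrm (1 + z + z * w) ^+ 2 = 3 + 2 * Re z + 2 * Re w + 2 * Re (z * w) :> R.
Proof.
move=> z1 w1; have := Rcomplex_sqr_norm z; have := Rcomplex_sqr_norm w.
rewrite z1 w1 Rcomplex_sqr_norm !Rcomplex_ReD !Rcomplex_ImD.
rewrite !Rcomplex_ReM !Rcomplex_ImM [Re 1]/(1 : R) [Im 1]/(0 : R).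
move: (Re z) (Im z) (Re w) (Im w) => p q r s; rewrite expr1n => e1 e2.
rewrite (_ : (1 + p + (p * r - q * s)) ^+ 2 + (0 + q + (p * s + q * r)) ^+ 2
  = 1 + 2 * p + (p ^+ 2 + q ^+ 2) + (p ^+ 2 + q ^+ 2) * (r ^+ 2 + s ^+ 2)
    + 2 * (p * r - q * s) + 2 * (p ^+ 2 + q ^+ 2) * r); last by ring.
by rewrite -e1 -e2; ring.
Qed.

End Rcomplex_norm.

(** * Turns along one arithmetic progression *)

Section Grid.
Variable R : realType.
Local Notation C := (Rcomplex R).

(** Unit modulus and 2-periodic real parts make the squared imaginary parts 2-periodic, so none of
    them vanishes. The condition on products then makes [y k * y k.+1] 3-periodic. *)
Lemma six_periodic (w : nat -> C) :
  (forall k, nrm (w k) = 1 :> R) ->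
  (forall k, Re (w k.+2) = Re (w k)) ->
  (forall k, Re (w k.+3 * w k.+4) = Re (w k * w k.+1)) ->
  Im (w 0%N) != 0 -> Im (w 1%N) != 0 ->
  forall k, w (k + 6)%N = w k.
Proof.
move=> w1 wRe wRe3 y0 y1.
pose y k := Im (w k).
have ysq k : y k.+2 ^+ 2 = y k ^+ 2.
  have := Rcomplex_sqr_norm (w k.+2); have := Rcomplex_sqr_norm (w k).
  by rewrite !w1 wRe /y => -> /addrI.
have ynz k : (y k != 0) && (y k.+1 != 0).
  elim: k => [|k /andP[yk yk1]]; first exact/andP.
  by rewrite yk1 -sqrf_eq0 ysq sqrf_eq0.
have yy k : y k.+3 * y k.+4 = y k * y k.+1.
  have := wRe3 k; rewrite !Rcomplex_ReM !wRe -!/(y _); lra.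
move=> k; rewrite !addnS addn0; apply: Rcomplex_eq; first by rewrite !wRe.
rewrite -!/(y _).
have /andP[n1 n2] := ynz k.+1; have /andP[n3 n4] := ynz k.+3.
(* After this multiplication both sides equal the product of [y] at [k + 3], ..., [k + 6], by
   3-periodicity of the neighbouring products. *)
apply: (mulfI (mulf_neq0 n3 (mulf_neq0 n1 n2))).
have e0 := yy k; have e1 := yy k.+1; have e2 := yy k.+2.
rewrite (_ : _ * y k.+4.+2 = (y k.+1 * y k.+2) * (y k.+3 * y k.+4.+2));
  last by ring.
rewrite (_ : _ * y k = (y k * y k.+1) * (y k.+2 * y k.+3)); last by ring.
by rewrite -e0 -e1 -e2; ring.
Qed.

(* The differences obey [v (k + 6) = Z * v k], so [g (k + 6) - Z * g k] is
   constant and for [Z != 1] the points [g (6 * n)] lie on a circle. *)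
Lemma affine_of_six_periodic (g : nat -> C) (Z : C) :
  nrm Z = 1 :> R ->
  (forall k, g (k + 6).+1%N - g (k + 6)%N = Z * (g k.+1 - g k)) ->
  ~ (exists M : R, forall n, nrm (g (6 * n)%N) <= M) ->
  forall k, g (k + 6)%N - g k = g 6%N - g 0%N.
Proof.
move=> Z1 gZ unb.
have gk k : g (k + 6)%N - Z * g k = g 6%N - Z * g 0%N.
  elim: k => [//|k <-].
  have := gZ k; rewrite mulrBr => /eqP; rewrite subr_eq => /eqP ->.
  by ring.
have [Z1e|Zn1] := eqVneq Z 1.
  by move=> k; have := gk k; rewrite Z1e !mul1r.
exfalso; apply: unb.
have Zn0 : 1 - Z != 0 by rewrite subr_eq0 eq_sym.
(* The centre of the circle: the fixed point of the affine map that takes [g k] to [g (k + 6)]. *)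
pose c := (g 6%N - Z * g 0%N) / (1 - Z).
have gc k : g (k + 6)%N - c = Z * (g k - c).
  have -> : g (k + 6)%N = (g 6%N - Z * g 0%N) + Z * g k.
    by rewrite -(gk k) subrK.
  rewrite -[g 6%N - _](mulfVK Zn0) -/c; ring.
have gn n : nrm (g (6 * n)%N - c) = nrm (g 0%N - c) :> R.
  elim: n => [|n IH]; first by rewrite muln0.
  by rewrite mulnSr gc Rcomplex_normM Z1 mul1r.
exists (nrm (g 0%N - c) + nrm c) => n.
rewrite -(gn n); have := ler_normD (g (6 * n)%N - c) c; by rewrite subrK.
Qed.

(** Equal single steps make the turns [w k] unit; the lengths of double and triple steps are those
    of [1 + w k] and [1 + w k + w k * w k.+1], which gives the periodicity that [six_periodic]
    needs. *)
Lemma grid_affine (g : nat -> C) :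
  g 1%N != g 0%N ->
  (forall k, nrm (g k.+2 - g k.+1) = nrm (g k.+1 - g k) :> R) ->
  (forall k, nrm (g k.+4 - g k.+2) = nrm (g k.+2 - g k) :> R) ->
  (forall k, nrm (g (k + 6)%N - g k.+3) = nrm (g k.+3 - g k) :> R) ->
  Im ((g 2%N - g 1%N) / (g 1%N - g 0%N)) != 0 ->
  Im ((g 3%N - g 2%N) / (g 2%N - g 1%N)) != 0 ->
  ~ (exists M : R, forall n, nrm (g (6 * n)%N) <= M) ->
  forall k, g (k + 6)%N - g k = g 6%N - g 0%N.
Proof.
move=> g10 H1 H2 H3 y0 y1 unb.
pose v k := g k.+1 - g k; pose w k := v k.+1 / v k.
pose rho : R := nrm (v 0%N).
have vr k : nrm (v k) = rho by elim: k => // k <-; rewrite /v H1.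
have rho0 : rho != 0 by rewrite normr_eq0 subr_eq0.
have v0 k : v k != 0 by rewrite -normr_eq0 vr.
have w1 k : nrm (w k) = 1 :> R.
  by rewrite Rcomplex_normM Rcomplex_normV !vr divff.
have vw k : v k.+1 = w k * v k by rewrite mulfVK.
rewrite -/(w 0%N) in y0; rewrite -/(w 1%N) in y1; clearbody w.
have g2 k : nrm (g k.+2 - g k) = nrm (1 + w k) * rho.
  rewrite -(vr k) -Rcomplex_normM mulrDl -vw mul1r /v; congr Num.norm; ring.
have g3 k : nrm (g k.+3 - g k) = nrm (1 + w k + w k * w k.+1) * rho.
  rewrite -(vr k) -Rcomplex_normM; congr Num.norm.
  rewrite (_ : g k.+3 - g k = v k.+2 + v k.+1 + v k); last by rewrite /v; ring.
  by rewrite !vw; ring.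
have wRe k : Re (w k.+2) = Re (w k).
  have := H2 k; rewrite !g2 => /(mulIf rho0) /(congr1 (fun t => t ^+ 2)).
  by rewrite !Rcomplex_sqr_norm_1D //; lra.
have wRe3 k : Re (w k.+3 * w k.+4) = Re (w k * w k.+1).
  have := H3 k; rewrite !addnS addn0 !g3 => /(mulIf rho0).
  move/(congr1 (fun t => t ^+ 2)).
  by rewrite !Rcomplex_sqr_norm_1DDM // !wRe; lra.
have w6 := six_periodic w1 wRe wRe3 y0 y1.
(* The factor carrying [v k] to [v (k + 6)]. Passing to [Z k.+1] trades [w k] for [w (k + 6)], so it
   is constant. *)
pose Z k := w k * w k.+1 * w k.+2 * w k.+3 * w k.+4 * w k.+4.+1.
have ZS k : Z k.+1 = Z k.
  by have := w6 k; rewrite /Z !addnS addn0 => ->; ring.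
have Z0 k : Z k = Z 0%N by elim: k => // k <-; rewrite ZS.
apply: (@affine_of_six_periodic g (Z 0%N)) => //.
  by rewrite /Z !Rcomplex_normM !w1 !mul1r.
move=> k; rewrite -(Z0 k) -!/(v _) !addnS addn0 !vw /Z; ring.
Qed.

End Grid.

(** * Equidistant maps satisfy Jensen's equation *)

Section Equidistant.
Variable R : realType.
Local Notation C := (Rcomplex R).
Variable g : R -> C.
Hypothesis g_equid : forall x d, nrm (g (x + d) - g x) = nrm (g x - g (x - d)).
Hypothesis g_inj : injective g.
Hypothesis g_unbounded : forall x d, d != 0 ->
  ~ (exists M : R, forall n, nrm (g (x + n%:R * d)) <= M).

Let straight x d := g (x + 2 * d) - g (x + d) = g (x + d) - g x.

Let step x d : nrm (g (x + 2 * d) - g (x + d)) = nrm (g (x + d) - g x).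
Proof.
have := g_equid (x + d) d.
by rewrite addrK -addrA (_ : d + d = 2 * d); last by ring.
Qed.

Let gneq x y : x != y -> g x - g y != 0.
Proof. by rewrite subr_eq0 (inj_eq g_inj). Qed.

Let addd_neq (x d : R) : d != 0 -> x + d != x.
Proof. by move=> d0; rewrite -[X in _ != X]addr0 (inj_eq (addrI x)). Qed.

(** Equality case of the triangle inequality for two increments of equal length. Straightness is
    thereby expressed by lengths, which equidistance transports. *)
Let straight_norm x d :
  straight x d <-> nrm (g (x + 2 * d) - g x) = 2 * nrm (g (x + d) - g x).
Proof.
rewrite /straight; have [->|d0] := eqVneq d 0.
  by rewrite !mulr0 !addr0 subrr normr0 mulr0.
have u0 := gneq (addd_neq x d0).
set u := g (x + d) - g x in u0 *; set v := g (x + 2 * d) - g (x + d).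
have -> : g (x + 2 * d) - g x = u + v by rewrite /u /v; ring.
split=> [->|e].
  by rewrite -mulr2n normrMn mulr_natl.
pose w := v / u; have vw : v = w * u by rewrite /w mulfVK.
have nu : nrm u != 0 by rewrite normr_eq0.
have w1 : nrm w = 1 :> R.
  by rewrite /w Rcomplex_normM Rcomplex_normV /v step divff.
have e1 : nrm (1 + w) = 2 :> R.
  apply: (mulIf nu); rewrite -Rcomplex_normM -e; congr Num.norm.
  by rewrite vw; ring.
have r1 : Re w = 1.
  by have := Rcomplex_sqr_norm_1D w1; rewrite e1; lra.
have := Rcomplex_sqr_norm w; rewrite w1 r1 expr1n -[LHS]addr0 => /addrI.
move/esym/eqP; rewrite sqrf_eq0 => /eqP i0.
have w1e : w = 1 by apply: Rcomplex_eq.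
by rewrite vw w1e mul1r.
Qed.

(** A shift by [2 * d] preserves both lengths in [straight_norm]: use [step] twice at step [d], once
    at step [2 * d]. *)
Let straightD x d : straight x d <-> straight (x + 2 * d) d.
Proof.
have e1 : nrm (g (x + 2 * d + d) - g (x + 2 * d)) = nrm (g (x + d) - g x).
  rewrite -(step x d) (_ : x + 2 * d = x + d + d); last by ring.
  by rewrite -(step (x + d) d); congr (nrm (g _ - g _)); ring.
have e2 : nrm (g (x + 2 * d + 2 * d) - g (x + 2 * d)) = nrm (g (x + 2 * d) - g x).
  by rewrite -(step x (2 * d)); congr (nrm (g _ - g _)); ring.
by split=> /straight_norm h; apply/straight_norm; move: h; rewrite e1 e2.
Qed.

(** A real ratio of modulus 1 is 1, which is straightness, or -1, which would give
    [g (x + 2 * d) = g x]. *)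
Let Im_ratio x d : d != 0 -> ~ straight x d ->
  Im ((g (x + 2 * d) - g (x + d)) / (g (x + d) - g x)) != 0.
Proof.
move=> d0 ns; apply/eqP => i0; apply: ns.
have u0 := gneq (addd_neq x d0).
have nu : nrm (g (x + d) - g x) != 0 by rewrite normr_eq0.
set w := _ / _ in i0.
have vw : g (x + 2 * d) - g (x + d) = w * (g (x + d) - g x) by rewrite /w mulfVK.
have w1 : nrm w = 1 :> R.
  by rewrite /w Rcomplex_normM Rcomplex_normV step divff.
have := Rcomplex_sqr_norm w; rewrite w1 i0 expr1n expr0n addr0 => /esym/eqP.
rewrite sqrf_eq1 => /orP[|] /eqP r1.
  have w1e : w = 1 by apply: Rcomplex_eq.
  by rewrite /straight vw w1e mul1r.
have w1e : w = -1 by apply: Rcomplex_eq; rewrite ?r1 // i0 raddfN /= oppr0.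
have : g (x + 2 * d) - g x = 0.
  have -> : g (x + 2 * d) - g x = w * (g (x + d) - g x) + (g (x + d) - g x).
    by rewrite -vw; ring.
  by rewrite w1e; ring.
move/eqP; rewrite (negPf (gneq _)) //.
by apply: addd_neq; rewrite mulf_neq0.
Qed.

(** Two adjacent nonzero turns suffice for [grid_affine]: [step] with [d], [2 * d] and [3 * d]
    supplies its length hypotheses. *)
Let grid6 x d : d != 0 -> ~ straight x d -> ~ straight (x + d) d ->
  forall k : nat, g (x + k%:R * d + 6 * d) - g (x + k%:R * d) = g (x + 6 * d) - g x.
Proof.
move=> d0 s0 s1 k.
pose G n := g (x + n%:R * d).
have := @grid_affine R G; rewrite /G => H.
have -> : g (x + k%:R * d + 6 * d) = g (x + (k + 6)%:R * d).
  by congr g; rewrite natrD; ring.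
suff : g (x + (k + 6)%:R * d) - g (x + k%:R * d) =
       g (x + 6%:R * d) - g (x + 0%:R * d) by rewrite mul0r addr0.
apply: H => {k}.
- by rewrite -subr_eq0 gneq // mul1r mul0r addr0 addd_neq.
- move=> k; have := step (x + k%:R * d) d.
  rewrite (_ : _ + 2 * d = x + k.+2%:R * d);
    last by rewrite -(addn2 k) natrD; ring.
  by rewrite (_ : x + k%:R * d + d = x + k.+1%:R * d);
    last by rewrite -(addn1 k) natrD; ring.
- move=> k; have := step (x + k%:R * d) (2 * d).
  rewrite (_ : _ + 2 * (2 * d) = x + k.+4%:R * d);
    last by rewrite -(addn4 k) natrD; ring.
  by rewrite (_ : x + k%:R * d + (2 * d) = x + k.+2%:R * d);
    last by rewrite -(addn2 k) natrD; ring.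
- move=> k; have := step (x + k%:R * d) (3 * d).
  rewrite (_ : _ + 2 * (3 * d) = x + (k + 6)%:R * d);
    last by rewrite natrD; ring.
  by rewrite (_ : x + k%:R * d + (3 * d) = x + k.+3%:R * d);
    last by rewrite -(addn3 k) natrD; ring.
- by have := Im_ratio d0 s0; rewrite mul1r mul0r addr0.
- have := Im_ratio d0 s1; rewrite mul1r.
  rewrite (_ : x + d + 2 * d = x + 3 * d); last by ring.
  by rewrite (_ : x + d + d = x + 2 * d); last by ring.
- move=> [M hM]; apply: (@g_unbounded x (6 * d)); first by rewrite mulf_neq0.
  by exists M => n; have := hM n; rewrite natrM [6%:R * _]mulrC mulrA.
Qed.

(** By [straightD] the four increments from [x] are a, a, b, b, and straightness at step [2 * d]
    says 2a = 2b. *)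
Let straight_double x d : straight x d -> straight x (2 * d) ->
  straight (x + d) d.
Proof.
move=> s0; have := (straightD x d).1 s0; move: s0.
rewrite /straight (_ : x + 2 * d + 2 * d = x + 2 * (2 * d)); last by ring.
rewrite (_ : x + d + 2 * d = x + 2 * d + d); last by ring.
rewrite (_ : x + d + d = x + 2 * d); last by ring.
move: (g (x + 2 * (2 * d))) (g (x + 2 * d + d)) (g (x + 2 * d)) (g (x + d)).
move: (g x) => [a0 b0] [a4 b4] [a3 b3] [a2 b2] [a1 b1] [e1 f1] [e2 f2] [e3 f3].
by apply: Rcomplex_eq => /=; lra.
Qed.

Let straight12 x d : d != 0 -> straight x d -> straight x (12 * d).
Proof.
move=> d0 s0.
have [s1|s1] := pselect (straight (x + d) d).
  (* [straightD] moves by two steps; [s0] and [s1] start the two parities. *)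
  have all_straight k : straight (x + k%:R * d) d.
    elim/ltn_ind: k => -[|[|k]] IH; rewrite ?mul0r ?addr0 ?mul1r //.
    have := IH k (leqW (leqnn _)); move/straightD.
    by rewrite -(addn2 k) natrD; congr straight; ring.
  have inc k : g (x + k.+1%:R * d) - g (x + k%:R * d) = g (x + d) - g x.
    elim: k => [|k IH]; first by rewrite mul1r mul0r addr0.
    rewrite -IH -[RHS]/(_ - _); have := all_straight k; rewrite /straight.
    have -> : x + k%:R * d + 2 * d = x + k.+2%:R * d
      by rewrite -(addn2 k) natrD; ring.
    by have -> : x + k%:R * d + d = x + k.+1%:R * d by rewrite -(addn1 k) natrD; ring.
  have sum k : g (x + k%:R * d) = g x + (g (x + d) - g x) *+ k.
    elim: k => [|k IH]; first by rewrite mul0r !addr0.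
    by rewrite [in RHS]mulrSr addrA -IH -(inc k) [RHS]addrC subrK.
  rewrite /straight (_ : 2 * (12 * d) = 24 * d); last by ring.
  by rewrite !sum; ring.
have d20 : 2 * d != 0 by rewrite mulf_neq0.
(* Straightness at step [2 * d] would, by [straight_double], remove a turn that [s1] keeps. *)
have ns0 : ~ straight x (2 * d) by move/(straight_double s0).
have ns1 : ~ straight (x + 2 * d) (2 * d).
  move/(straight_double ((straightD x d).1 s0)); rewrite addrAC.
  by move/(straightD _ _).2.
have g6 := grid6 d20 ns0 ns1.
rewrite /straight.
have := g6 6%N; have -> : x + 6 * (2 * d) + 6 * (2 * d) = x + 2 * (12 * d) by ring.
by have -> : x + 6 * (2 * d) = x + 12 * d by ring.
Qed.

(* If only every other turn vanishes, the progression of step [2 d] has no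
   vanishing turn and is affine on every sixth point, hence the factor 12. *)
Let straight_all x d : d != 0 -> straight x (12 * d).
Proof.
move=> d0.
have [s0|s0] := pselect (straight x d); first exact: straight12.
have [s1|s1] := pselect (straight (x + d) d); last first.
  have g6 := grid6 d0 s0 s1; rewrite /straight.
  have -> : x + 2 * (12 * d) = x + 18%:R * d + 6 * d by ring.
  (* The values at [x], [x + 6 * d], ..., [x + 24 * d] are equally spaced; only every second one
     enters the goal. *)
  have := g6 18%N; have := g6 12%N; have := g6 6%N.
  have -> : x + 12%:R * d + 6 * d = x + 18%:R * d by ring.
  have -> : x + 6%:R * d + 6 * d = x + 12 * d by ring.
  move: (g _) (g (x + 18%:R * d)) (g (x + 12 * d)) (g (x + 6 * d)) (g x).
  move=> [a4 b4] [a3 b3] [a2 b2] [a1 b1] [a0 b0] [e1 f1] [e2 f2] [e3 f3].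
  by apply: Rcomplex_eq => /=; lra.
(* Now [g x] is the midpoint of [g (x - d)] and [g (x + d)], and likewise after shifts by [12 * d]
   and [24 * d]. Averaging [straight12] at [x - d] and [x + d] gives the claim at [x]. *)
have sm : straight (x - d) d.
  by apply/straightD; rewrite (_ : _ + 2 * d = x + d) //; ring.
have := straight12 d0 sm; have := straight12 d0 s1.
have even_straight k : straight (x - d + k%:R * (2 * d)) d.
  elim: k => [|k IH]; first by rewrite mul0r addr0.
  by move/straightD: IH; congr straight; rewrite -natr1; ring.
have := even_straight 12%N; have := even_straight 6%N; move: sm.
rewrite /straight.
have -> : x - d + 2 * d = x + d by ring.
have -> : x - d + d = x by ring.
have -> : x - d + 6%:R * (2 * d) + 2 * d = x + d + 12 * d by ring.
have -> : x - d + 6%:R * (2 * d) + d = x + 12 * d by ring.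
have -> : x - d + 6%:R * (2 * d) = x - d + 12 * d by ring.
have -> : x - d + 12%:R * (2 * d) + 2 * d = x + d + 2 * (12 * d) by ring.
have -> : x - d + 12%:R * (2 * d) + d = x + 2 * (12 * d) by ring.
have -> : x - d + 12%:R * (2 * d) = x - d + 2 * (12 * d) by ring.
move: (g (x - d + 2 * (12 * d))) (g (x + 2 * (12 * d))).
move: (g (x + d + 2 * (12 * d))) (g (x - d + 12 * d)) (g (x + 12 * d)).
move: (g (x + d + 12 * d)) (g (x - d)) (g (x + d)) (g x).
move=> [a1 b1] [a2 b2] [a3 b3] [a4 b4] [a5 b5] [a6 b6] [a7 b7] [a8 b8] [a9 b9].
move=> [e1 f1] [e2 f2] [e3 f3] [e4 f4] [e5 f5].
by apply: Rcomplex_eq => /=; lra.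
Qed.

(** Jensen's equation, from [straight_all] with step [d / 12]. *)
Lemma equidistant_midpoint x d : g (x + d) + g (x - d) = g x + g x.
Proof.
have [->|d0] := eqVneq d 0; first by rewrite subr0 addr0.
have d12 : d / 12 != 0 by rewrite mulf_neq0.
have := straight_all (x - d) d12; rewrite /straight.
have -> : x - d + 2 * (12 * (d / 12)) = x + d by field.
have -> : x - d + 12 * (d / 12) = x by field.
move=> /eqP; rewrite subr_eq => /eqP ->; ring.
Qed.

(** Jensen's equation and [g 0 = 0] give additivity; the bound on [0, 1] replaces continuity.
    Splitting n s into integer part and remainder gives n |g s| <= K + n s |g 1|, and large n
    absorbs K. *)
Lemma equidistant_linear_bound : g 0 = 0 ->
  (exists2 K : R, 0 <= K & forall u, 0 <= u <= 1 -> nrm (g u) <= K) ->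
  forall s, nrm (g s) <= `|s| * nrm (g 1).
Proof.
move=> g0 [K K0 gK].
have gN s : g (- s) = - g s.
  have := equidistant_midpoint 0 s; rewrite add0r sub0r g0 addr0.
  by move/eqP; rewrite addrC addr_eq0 => /eqP.
have gD s t : g (s + t) = g s + g t.
  have := equidistant_midpoint ((s + t) / 2) ((s + t) / 2).
  rewrite subrr g0 addr0 -splitr => ->.
  have := equidistant_midpoint ((s + t) / 2) ((s - t) / 2).
  have -> : (s + t) / 2 + (s - t) / 2 = s by field.
  by have -> : (s + t) / 2 - (s - t) / 2 = t by field.
have gM n s : g (n%:R * s) = g s *+ n.
  by elim: n => [|n IH]; rewrite ?mul0r // -natr1 mulrDl mul1r gD IH mulrSr.
have pos s : 0 <= s -> nrm (g s) <= s * nrm (g 1).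
  move=> s0; rewrite -subr_le0 leNgt; apply/negP => h.
  set c := _ - _ in h.
  have [n nK] : exists n : nat, K / c < n%:R.
    exists (Num.bound (K / c)).
    by apply: archi_boundP; rewrite divr_ge0 // ltW.
  have sn0 : 0 <= n%:R * s by rewrite mulr_ge0.
  have /andP[m1 m2] := truncn_itv sn0.
  set m := Num.truncn _ in m1 m2.
  have := ler_normD (g (n%:R * s - m%:R)) (g (m%:R * 1)); rewrite -gD.
  rewrite mulr1 subrK gM -[m%:R]mulr1 gM !normrMn mulr1.
  have := gK (n%:R * s - m%:R); rewrite subr_ge0 m1 -natr1 in m2 *.
  rewrite /= lerBlDl ltW // => /(_ isT) g1 g2.
  have g3 : nrm (g 1) * m%:R <= nrm (g 1) * (n%:R * s) by rewrite ler_wpM2l.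
  move: g2; rewrite -[_ *+ n]mulr_natr -[nrm (g 1) *+ m]mulr_natr => g2.
  by move: nK; rewrite ltr_pdivrMr // /c; lra.
move=> s; have [s0|s0] := leP 0 s; first by rewrite (ger0_norm s0) pos.
rewrite (ltr0_norm s0) -[nrm (g s)]normrN -gN pos //.
by rewrite oppr_ge0 ltW.
Qed.

End Equidistant.

(** * Blow-up *)

Section Ultralimits.
Variables (R : realType) (T : Type) (U : set_system T).
Context {FU : UltraFilter U}.

(** Compactness gives a cluster point; an ultrafilter contains each set or its complement, so it
    converges there. *)
Lemma ultra_bounded_cvg (u : T -> R) (M : R) :
  (\forall n \near U, `|u n| <= M) -> exists l : R, u @ U --> l.
Proof.
move=> uM.
have cpt := @segment_compact R (- M) M.
have : (u @ U) `[- M, M]%classic.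
  by near=> n => /=; rewrite in_itv /= -ler_norml; near: n.
move=> /(cpt (u @ U) _) [l [_ cl]]; exists l => A Al.
have [//|UA] := in_ultra_setVsetC (u @^-1` A) FU.
have [z [/= nAz Az]] := cl (~` A) A UA Al.
by case: nAz.
Unshelve. all: by end_near. Qed.

Lemma ultra_bounded_cvg_complex (u : T -> Rcomplex R) (M : R) :
  (\forall n \near U, nrm (u n) <= M) -> exists l : Rcomplex R, u @ U --> l.
Proof.
move=> uM.
have bRe (z : Rcomplex R) : `|Re z| <= nrm z :> R.
  rewrite -ler_sqr ?nnegrE // Rcomplex_sqr_norm -normrX ger0_norm ?sqr_ge0 //.
  by rewrite lerDl sqr_ge0.
have bIm (z : Rcomplex R) : `|Im z| <= nrm z :> R.
  rewrite -ler_sqr ?nnegrE // Rcomplex_sqr_norm -normrX ger0_norm ?sqr_ge0 //.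
  by rewrite lerDr sqr_ge0.
have [a ua] : exists a : R, Re \o u @ U --> a.
  apply: (@ultra_bounded_cvg _ M); near=> n.
  by apply: le_trans (bRe _) _; near: n.
have [c uc] : exists c : R, Im \o u @ U --> c.
  apply: (@ultra_bounded_cvg _ M); near=> n.
  by apply: le_trans (bIm _) _; near: n.
exists (a *: (1 : Rcomplex R) + c *: ('i%C : Rcomplex R)).
have -> : u = fun n => Re (u n) *: (1 : Rcomplex R) + Im (u n) *: ('i%C : Rcomplex R).
  apply/funext => n; case: (u n) => x y.
  by apply: Rcomplex_eq => /=; rewrite ?mulr0 ?mulr1 ?addr0 ?add0r.
by apply: cvgD; apply: cvgZr_tmp.
Unshelve. all: by end_near. Qed.

End Ultralimits.

(** * Small-scale geometry of a parametrised curve [p] and of its image [F] *)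

Section BlowUp.
Variables (R : realType) (X : metricType R) (p : R -> X) (F : R -> Rcomplex R).
Local Notation D s u := (mdist (p s) (p u)).
Local Notation E s u := (nrm (F s - F u)).
Hypothesis p_inj : injective p.
Hypothesis F_inj : injective F.
Hypothesis conf : forall e : R, 0 < e -> exists2 r : R, 0 < r &
  forall u w v, u <= w -> w <= v -> D u v <= r ->
    D u w + D w v <= (1 + e) * D u v.
Hypothesis right_pt : forall u r : R, 0 < r -> exists2 s, u < s & D u s = r.
Hypothesis left_pt : forall u r : R, 0 < r -> exists2 s, s < u & D u s = r.
Hypothesis qs_bounded : forall t : R, exists2 K : R, 0 <= K &
  forall a b x, D x a <= t * D x b -> E a x <= K * E b x.
Hypothesis qs_small : forall e : R, 0 < e -> exists2 t : R, 0 < t &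
  forall a b x, D x a <= t * D x b -> E a x <= e * E b x.
Hypothesis ewas : forall e : R, 0 < e -> exists2 r : R, 0 < r &
  forall a b x, D x a = D x b -> D x b <= r -> E a x <= (1 + e) * E b x.

(** The sign records the side of [x] in the order of the parameter. In this coordinate the rescaled
    curves become a straight line. *)
Definition sdist x y := if x <= y then D x y else - D x y.

Lemma norm_sdist x y : `|sdist x y| = D x y.
Proof. by rewrite /sdist; case: ifP; rewrite ?normrN ger0_norm ?mdist_ge0. Qed.

Lemma sdist_surj x tau : exists y, sdist x y = tau.
Proof.
have [t0|t0|<-] := ltgtP 0 tau.
- have [s xs <-] := right_pt x t0; exists s.
  by rewrite /sdist ltW.
- have Nt0 : 0 < - tau by rewrite oppr_gt0.
  have [s xs e] := left_pt x Nt0; exists s.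
  by rewrite /sdist leNgt xs /= e opprK.
- by exists x; rewrite /sdist lexx mdistxx.
Qed.

(* Near [x], the signed distance to [x] is an almost isometric coordinate. *)
Lemma mdist_sdist e r x y z : 0 < e ->
  (forall u w v, u <= w -> w <= v -> D u v <= r ->
    D u w + D w v <= (1 + e) * D u v) ->
  D x y + D x z <= r ->
  `|D y z - `|sdist x y - sdist x z| | <= e * (D x y + D x z).
Proof.
move=> e0 He; wlog yz : y z / y <= z => [hw|].
  have [|/ltW] := leP y z; first exact: hw.
  move=> /hw {}hw hr; rewrite metric_sym (distrC (sdist x y)).
  by rewrite [D x y + _]addrC; apply: hw; rewrite addrC.
move=> hr.
have h1 := metric_triangle (p x) (p y) (p z).
have h2 := metric_triangle (p x) (p z) (p y).
have h3 := metric_triangle (p y) (p x) (p z).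
rewrite [mdist (p y) (p x)]metric_sym in h3.
rewrite [mdist (p z) (p y)]metric_sym in h2.
have n1 := mdist_ge0 (p x) (p y); have n2 := mdist_ge0 (p x) (p z).
have n3 := mdist_ge0 (p y) (p z).
rewrite /sdist ler_norml.
(* Three positions of [x] relative to [y <= z]. In each, [He] is applied with the middle one of the
   three points, and the triangle inequality gives the other bound. *)
have [xy|yx] := leP x y.
  rewrite (le_trans xy yz).
  have := He _ _ _ xy yz.
  have -> : D x z <= r by lra.
  move=> /(_ isT) H.
  by have [H1|H1] := leP 0 (D x y - D x z);
    rewrite ?(ger0_norm H1) ?(ltr0_norm H1); apply/andP; split; nra.
have [xz|zx] := leP x z.
  have := He _ _ _ (ltW yx) xz.
  have -> : D y z <= r by lra.
  move=> /(_ isT); rewrite [mdist (p y) (p x)]metric_sym => H.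
  rewrite ler0_norm; last by lra.
  by apply/andP; split; nra.
have := He _ _ _ yz (ltW zx).
rewrite [mdist (p y) (p x)]metric_sym [mdist (p z) (p x)]metric_sym.
have -> : D x y <= r by lra.
move=> /(_ isT) H.
by have [H1|H1] := leP 0 (- D x y - - D x z);
  rewrite ?(ger0_norm H1) ?(ltr0_norm H1); apply/andP; split; nra.
Qed.

(** Equicontinuity of the rescaled maps. [z] is at least [D x b / 2] away from [x] or from [b];
    [qs_small] centred at [z] compares [y] with that point, whose image is within [(K + 1) * E b x]
    of that of [z]. *)
Lemma image_modulus M e : 0 < e -> exists2 tau : R, 0 < tau &
  forall x b y z, D x z <= M * D x b -> D z y <= tau * D x b ->
    E y z <= e * E b x.
Proof.
move=> e0; have [K K0 HK] := qs_bounded M.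
have e1 : 0 < e / (K + 1) by rewrite divr_gt0 // ltr_wpDl.
have [t t0 Ht] := qs_small e1.
exists (t / 2); first by rewrite divr_gt0.
move=> x b y z xz zy.
have Kz := HK _ _ _ xz.
have tri := metric_triangle (p x) (p z) (p b).
have ee : e = e / (K + 1) * (K + 1) by rewrite mulfVK // gt_eqF // ltr_wpDl.
have nb : 0 <= E b x by [].
have nz : 0 <= E z x by [].
move: (e / (K + 1)) e1 Ht ee => e' e'0 Ht ->.
have [h|h] := leP (D x b / 2) (D z x).
  have /Ht : D z y <= t * D z x by nra.
  by rewrite [nrm (F x - F z)]distrC => h1; nra.
have /Ht : D z y <= t * D z b.
  by rewrite [mdist (p x) (p z)]metric_sym in tri; nra.
have : E b z <= E b x + E z x.
  by rewrite [nrm (F z - F x)]distrC (ler_distD (F x)).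
by move=> h2 h1; nra.
Qed.

(** * Rescaled maps along a sequence of triples and their limit *)

Section Sequence.
Variables (U : set_system nat) (x b : nat -> R).
Context {FU : UltraFilter U}.
Hypothesis xb : forall n, b n != x n.
Hypothesis scale0 : forall r : R, 0 < r -> \forall n \near U, D (x n) (b n) <= r.

(** [rho] and [lam] are the scales in source and target. [sigma] is the rescaled coordinate, and [G]
    the rescaled image, normalised so that [x n] goes to 0 and [b n] to 1. *)
Let rho n := D (x n) (b n).
Let lam n := E (b n) (x n).
Let sigma (y : nat -> R) n := sdist (x n) (y n) / rho n.
Let G (y : nat -> R) n : Rcomplex R := (F (y n) - F (x n)) / (F (b n) - F (x n)).

Let rho_gt0 n : 0 < rho n.
Proof. by rewrite mdist_gt0 (inj_eq p_inj) eq_sym xb. Qed.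

Let lam_gt0 n : 0 < lam n.
Proof. by rewrite normr_gt0 subr_eq0 (inj_eq F_inj) xb. Qed.

Let norm_G y n : nrm (G y n) = E (y n) (x n) / lam n.
Proof. by rewrite /G Rcomplex_normM Rcomplex_normV. Qed.

Let norm_GB y z n : nrm (G y n - G z n) = E (y n) (z n) / lam n.
Proof.
rewrite /G -mulrBl Rcomplex_normM Rcomplex_normV; congr (nrm _ / _).
by rewrite opprB addrA subrK.
Qed.

Let norm_sigma y n : `|sigma y n| = D (x n) (y n) / rho n.
Proof. by rewrite /sigma normrM normfV norm_sdist (gtr0_norm (rho_gt0 n)). Qed.

Let sigma_point s : exists y, forall n, sigma y n = s.
Proof.
have /choice[y yE] : forall n, exists y, sdist (x n) y = s * rho n.
  by move=> n; exact: sdist_surj.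
by exists y => n; rewrite /sigma yE mulfK // gt_eqF.
Qed.

Let cvg_bounded (u : nat -> R) (l : R) : u @ U --> l ->
  \forall n \near U, `|u n| <= `|l| + 1.
Proof.
move=> /cvgrPdist_le /(_ 1 ltr01); apply: filterS => n.
by have := ler_normB l (l - u n); rewrite opprB addrC subrK; lra.
Qed.

(** Points with convergent coordinates stay within a bounded multiple of [rho n] of [x n], where
    [mdist_sdist] holds with arbitrarily small relative error. *)
Let D_cvg y z (s t : R) : sigma y @ U --> s -> sigma z @ U --> t ->
  (fun n => D (y n) (z n) / rho n) @ U --> `|s - t|.
Proof.
move=> ys zt.
have st : (fun n => `|sigma y n - sigma z n|) @ U --> `|s - t|.
  by apply: cvg_norm; apply: cvgB.
pose err n := D (y n) (z n) / rho n - `|sigma y n - sigma z n|.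
have -> : (fun n => D (y n) (z n) / rho n) =
    (fun n => err n + `|sigma y n - sigma z n|).
  by apply/funext => n; rewrite /err subrK.
rewrite -[X in _ --> X]add0r; apply: cvgD => //.
apply/cvgr0Pnorm_le => e e0.
(* Eventually bounds the sum of both coordinates, with slack 1 for each; a relative error [e / M]
   then costs at most [e]. *)
pose M := `|s| + `|t| + 2.
have M0 : 0 < M by rewrite ltr_wpDl // addr_ge0.
have e1 : 0 < e / M by rewrite divr_gt0.
have [r r0 Hr] := conf e1.
have sc := scale0 (divr_gt0 r0 M0).
near=> n.
have ny : `|sigma y n| <= `|s| + 1 by near: n; exact: cvg_bounded.
have nz : `|sigma z n| <= `|t| + 1 by near: n; exact: cvg_bounded.
have rn : rho n <= r / M by near: n.
have rho0 := rho_gt0 n.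
have sum : D (x n) (y n) / rho n + D (x n) (z n) / rho n <= M.
  by rewrite -!norm_sigma /M; lra.
have small : D (x n) (y n) + D (x n) (z n) <= M * rho n.
  by rewrite -ler_pdivrMr // mulrDl.
have small' : D (x n) (y n) + D (x n) (z n) <= r.
  by apply: le_trans small _; rewrite mulrC -ler_pdivlMr.
have := mdist_sdist e1 Hr small'.
have -> : err n = (D (y n) (z n) - `|sdist (x n) (y n) - sdist (x n) (z n)|) / rho n.
  by rewrite /err /sigma -mulrBl normrM normfV (gtr0_norm rho0) mulrBl.
rewrite normrM normfV (gtr0_norm rho0) ler_pdivrMr // => h.
apply: le_trans h _; rewrite -[X in _ <= X * _](mulfVK (lt0r_neq0 M0)).
rewrite -[X in _ <= X]mulrA.
by rewrite ler_wpM2l // ltW.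
Unshelve. all: by end_near. Qed.

Let G_close y z (s : R) : sigma y @ U --> s -> sigma z @ U --> s ->
  (fun n => G y n - G z n) @ U --> (0 : Rcomplex R).
Proof.
move=> ys zs; apply/cvgr0Pnorm_le => e e0.
have [tau tau0 Htau] := image_modulus (`|s| + 1) e0.
have := D_cvg zs ys; rewrite subrr normr0 => /cvgr0Pnorm_le /(_ _ tau0) close.
near=> n; rewrite norm_GB ler_pdivrMr // [nrm (F _ - _)]distrC.
have rho0 := rho_gt0 n.
have nz : `|sigma y n| <= `|s| + 1 by near: n; exact: cvg_bounded.
have cl : `|D (z n) (y n) / rho n| <= tau by near: n.
apply: Htau.
  by move: nz; rewrite norm_sigma ler_pdivrMr.
by move: cl; rewrite ger0_norm ?divr_ge0 ?mdist_ge0 // ler_pdivrMr // metric_sym.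
Unshelve. all: by end_near. Qed.

Let G_cvg y (s : R) : sigma y @ U --> s -> exists l : Rcomplex R, G y @ U --> l.
Proof.
move=> ys; have [K K0 HK] := qs_bounded (`|s| + 1).
apply: (@ultra_bounded_cvg_complex R _ U FU _ K); near=> n.
rewrite norm_G ler_pdivrMr //; apply: HK.
have : `|sigma y n| <= `|s| + 1 by near: n; exact: cvg_bounded.
by rewrite norm_sigma ler_pdivrMr.
Unshelve. all: by end_near. Qed.

(** The limit is taken along points whose coordinate is exactly [s]; [G_close] makes it independent
    of that choice. *)
Let limit_exists : exists g : R -> Rcomplex R,
  forall y (s : R), sigma y @ U --> s -> G y @ U --> g s.
Proof.
have /choice[y yE] := sigma_point.
have ys (s : R) : sigma (y s) @ U --> s.
  by rewrite (_ : sigma _ = fun=> s); [exact: cvg_cst | apply/funext].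
have /choice[g gE] : forall s, exists l : Rcomplex R, G (y s) @ U --> l.
  by move=> s; exact: G_cvg (ys s).
exists g => z s zs.
have -> : G z = fun n => (G z n - G (y s) n) + G (y s) n.
  by apply/funext => n; rewrite subrK.
rewrite -[g s]add0r; apply: cvgD; last exact: gE.
exact: G_close zs (ys s).
Qed.

(** * Properties of the limit map *)

Section Limit.
Variable g : R -> Rcomplex R.
Hypothesis gP : forall y (s : R), sigma y @ U --> s -> G y @ U --> g s.

Let point (s : R) : exists2 y, (forall n, sigma y n = s) & sigma y @ U --> s.
Proof.
have [y yE] := sigma_point s; exists y => //.
by rewrite (_ : sigma _ = fun=> s); [exact: cvg_cst | apply/funext].
Qed.

Let E_cvg y z (s t : R) : sigma y @ U --> s -> sigma z @ U --> t ->
  (fun n => E (y n) (z n) / lam n) @ U --> (nrm (g s - g t) : R).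
Proof.
move=> ys zt; rewrite (_ : (fun n => _) = fun n => nrm (G y n - G z n)).
  by apply: cvg_norm; apply: cvgB; exact: gP.
by apply/funext => n; rewrite norm_GB.
Qed.

(** The premise is strict so that it already holds along the ultrafilter before the limit. *)
Let limit_qs t K :
  (forall a b x, D x a <= t * D x b -> E a x <= K * E b x) ->
  forall a c z, `|z - a| < t * `|z - c| ->
    nrm (g a - g z) <= K * nrm (g c - g z).
Proof.
move=> HK a c z zac.
have [ya _ Ya] := point a; have [yc _ Yc] := point c; have [yz _ Yz] := point z.
have e1 := E_cvg Ya Yz; have e2 := E_cvg Yc Yz.
have d1 := D_cvg Yz Ya; have d2 := D_cvg Yz Yc.
have near_lt : \forall n \near U,
    D (yz n) (ya n) / rho n < t * (D (yz n) (yc n) / rho n).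
  have d3 : (fun n => t * (D (yz n) (yc n) / rho n) - D (yz n) (ya n) / rho n)
      @ U --> t * `|z - c| - `|z - a|.
    by apply: cvgB => //; apply: cvgMl_tmp.
  have H : 0 < t * `|z - c| - `|z - a| by rewrite subr_gt0.
  by near=> n; rewrite -subr_gt0; near: n; exact: (cvgr_gt _ d3 _ H).
have := ler_cvg_to e1 (@cvgMl_tmp _ _ _ _ _ K _ e2); apply; near=> n.
rewrite mulrA ler_pM2r ?invr_gt0 //; apply: HK.
have : D (yz n) (ya n) / rho n < t * (D (yz n) (yc n) / rho n) by near: n.
by rewrite mulrA ltr_pM2r ?invr_gt0 // => /ltW.
Unshelve. all: by end_near. Qed.

Let limit0 : g 0 = 0.
Proof.
have x0 : sigma x @ U --> (0 : R).
  rewrite (_ : sigma x = fun=> 0); first exact: cvg_cst.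
  by apply/funext => n; rewrite /sigma /sdist lexx mdistxx mul0r.
have := gP x0; rewrite (_ : G x = fun=> 0); last first.
  by apply/funext => n; rewrite /G subrr mul0r.
by move=> h; apply: (cvg_unique (@norm_hausdorff _ _) h (cvg_cst _)).
Qed.

(** [b n] may lie on either side of [x n], so the point of coordinate 1 is compared with it through
    their equal distance to [x n], by [ewas] in both directions. *)
Let limit1 : nrm (g 1) = 1 :> R.
Proof.
have [y yE Y1] := point 1.
have c1 : (fun n => nrm (G y n)) @ U --> (nrm (g 1) : R).
  by apply: cvg_norm; exact: gP.
have Dy n : D (x n) (y n) = D (x n) (b n).
  by have := norm_sigma y n; rewrite yE normr1 => /esym /divr1_eq.
have le1 : nrm (g 1) <= 1.
  apply/ler_addgt0Pr => e e0; have [r r0 Hr] := ewas e0.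
  apply: (ler_cvg_to c1 (cvg_cst _)); near=> n.
  rewrite norm_G ler_pdivrMr //; apply: Hr => //.
  by near: n; exact: scale0.
apply: le_anti; rewrite le1 /=.
apply/ler_addgt0Pr => e e0; have [r r0 Hr] := ewas e0.
have : 1 <= (1 + e) * nrm (g 1).
  apply: (ler_cvg_to (cvg_cst _) (@cvgMl_tmp _ _ _ _ _ (1 + e) _ c1)); near=> n.
  rewrite norm_G mulrA ler_pdivlMr // mul1r; apply: Hr => //.
  by rewrite Dy; near: n; exact: scale0.
by move=> h; nra.
Unshelve. all: by end_near. Qed.

(** By quasisymmetry one collapsed pair makes [g] constant, against [limit0] and [limit1]. *)
Let limit_inj : injective g.
Proof.
move=> a c gac; apply: contrapT => /eqP ac.
have ac0 : 0 < `|c - a| by rewrite normr_gt0 subr_eq0 eq_sym.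
have gconst z : g z = g c.
  have [K K0 HK] := qs_bounded ((`|c - z| + 1) / `|c - a|).
  have := limit_qs HK (a := z) (c := a) (z := c).
  rewrite mulfVK ?gt_eqF // ltrDl ltr01 gac subrr normr0 mulr0 => /(_ isT).
  by rewrite normr_le0 subr_eq0 => /eqP.
have := limit1; rewrite gconst -(gconst 0) limit0 normr0 => /esym/eqP.
by rewrite oner_eq0.
Qed.

(** [ewas] needs exactly equal distances, whereas points of coordinates [s - d] and [s + d] are
    equidistant from one of coordinate [s] only in the limit. So one of them is replaced by a
    reflected point, whose limit coordinate is computed afterwards. *)
Let limit_equid_le s d : nrm (g (s + d) - g s) <= nrm (g s - g (s - d)).
Proof.
have [zz zE Z] := point (s - d); have [cc cE Cc] := point s.
(* [q n] lies on the opposite side of [cc n] from [zz n], at the same distance. *)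
have /choice[q qE] : forall n, exists q, sdist (cc n) q = - sdist (cc n) (zz n).
  by move=> n; exact: sdist_surj.
have Dq n : D (cc n) (q n) = D (cc n) (zz n).
  by rewrite -!norm_sdist qE normrN.
have dcz := D_cvg Cc Z; rewrite opprB addrCA subrr addr0 in dcz.
have [tau Q] : exists tau : R, sigma q @ U --> tau.
  apply: (@ultra_bounded_cvg R _ U FU _ (`|s| + (`|d| + 1))); near=> n.
  rewrite norm_sigma.
  have tri : D (x n) (q n) <= D (x n) (cc n) + D (cc n) (q n).
    exact: metric_triangle.
  have h1 : D (x n) (cc n) / rho n = `|s| by rewrite -norm_sigma cE.
  have h2 : `|D (cc n) (zz n) / rho n| <= `| `|d| | + 1.
    by near: n; exact: cvg_bounded.
  have := tri; rewrite -(ler_pM2r (_ : 0 < (rho n)^-1)) ?invr_gt0 // mulrDl h1 Dq.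
  move/le_trans; apply; rewrite lerD2l; move: h2; rewrite normr_id.
  by apply: le_trans; exact: ler_norm.
have dcq := D_cvg Cc Q; have dzq := D_cvg Z Q.
have e1 : `|s - tau| = `|d|.
  apply: (cvg_unique (@norm_hausdorff _ _) dcq); move: dcz.
  rewrite (_ : (fun n => D (cc n) (q n) / rho n) =
    (fun n => D (cc n) (zz n) / rho n)) //.
  by apply/funext => n; rewrite Dq.
have small r : 0 < r -> \forall n \near U, D (cc n) (zz n) <= r.
  move=> r0; have d1 : 0 < `|d| + 1 by rewrite ltr_wpDl.
  have sc := scale0 (divr_gt0 r0 d1).
  near=> n.
  have h2 : `|D (cc n) (zz n) / rho n| <= `| `|d| | + 1.
    by near: n; exact: cvg_bounded.
  have h3 : rho n <= r / (`|d| + 1) by near: n.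
  move: h2; rewrite normr_id => /(le_trans (ler_norm _)).
  rewrite ler_pdivrMr // => /le_trans; apply.
  by rewrite mulrC -ler_pdivlMr.
(* [e1] leaves [s + d] and [s - d] for [tau]. Opposite signed distances from [cc n] put [q n] and
   [zz n] almost twice as far apart, which excludes [s - d] unless [d = 0]. *)
have e2 : 2 * `|d| <= `|s - d - tau|.
  apply/ler_addgt0Pr => e e0.
  have d1 : 0 < 2 * `|d| + 1 by rewrite ltr_wpDl // mulr_ge0.
  have e1' : 0 < e / (2 * `|d| + 1) by rewrite divr_gt0.
  have eE : e = e / (2 * `|d| + 1) * (2 * `|d| + 1) by rewrite mulfVK // gt_eqF.
  have [r r0 Hr] := conf e1'.
  move: (e / _) e1' eE Hr => e' e'0 eE Hr.
  have sm := small _ (divr_gt0 r0 (ltr0n _ 2)).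
  have : (2 - 2 * e') * `|d| <= `|s - d - tau|.
    apply: (ler_cvg_to (@cvgMl_tmp _ _ _ _ _ (2 - 2 * e') _ dcz) dzq); near=> n.
    rewrite mulrA ler_pM2r ?invr_gt0 //.
    have smn : D (cc n) (zz n) <= r / 2 by near: n.
    have := @mdist_sdist e' r (cc n) (zz n) (q n) e'0 Hr.
    rewrite Dq qE opprK -[sdist _ _ + _]mulr2n normrMn norm_sdist -mulr_natl.
    have -> : D (cc n) (zz n) + D (cc n) (zz n) <= r by lra.
    move=> /(_ isT); rewrite ler_norml => /andP[+ _]; lra.
  have := normr_ge0 d; nra.
have tauE : tau = s + d.
  have /eqP := e1; rewrite eqr_norm2 => /orP[|] /eqP st; last by lra.
  have tE : tau = s - d by lra.
  move: e2; rewrite tE subrr normr0 => e2.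
  have : `|d| <= 0 by lra.
  by rewrite normr_le0 => /eqP ->; lra.
rewrite tauE in Q.
have l1 := E_cvg Q Cc; have l2 := E_cvg Cc Z.
apply/ler_addgt0Pr => e e0.
pose m : R := nrm (g s - g (s - d)); rewrite -/m.
have m0 : 0 <= m by exact: normr_ge0.
have m1 : 0 < m + 1 by exact: ltr_wpDl m0 ltr01.
have e1' : 0 < e / (m + 1) by rewrite divr_gt0.
have eE : e = e / (m + 1) * (m + 1) by rewrite mulfVK // gt_eqF.
have [r r0 Hr] := ewas e1'.
move: (e / _) e1' eE Hr => e' e'0 eE Hr.
have sm := small _ r0.
have : nrm (g (s + d) - g s) <= (1 + e') * m.
  apply: (ler_cvg_to l1 (@cvgMl_tmp _ _ _ _ _ (1 + e') _ l2)); near=> n.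
  rewrite mulrA ler_pM2r ?invr_gt0 // [nrm (F (cc n) - _)]distrC.
  by apply: Hr => //; near: n.
by move=> h; nra.
Unshelve. all: by end_near. Qed.

Let limit_equid s d : nrm (g (s + d) - g s) = nrm (g s - g (s - d)).
Proof.
apply: le_anti; rewrite limit_equid_le /=.
have := limit_equid_le s (- d); rewrite opprK.
by rewrite distrC [nrm (g s - g (s + d))]distrC.
Qed.

(** By quasisymmetry centred at [s], a distant term of the progression has an image more than
    [2 * M] from [g s]. *)
Let limit_unbounded s d : d != 0 ->
  ~ (exists M : R, forall n, nrm (g (s + n%:R * d)) <= M).
Proof.
move=> d0 [M gM].
have u0 : 0 < nrm (g (s + d) - g s).
  by rewrite normr_gt0 subr_eq0 (inj_eq limit_inj) -subr_eq0 addrC addKr.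
have Mge : 0 <= M by apply: le_trans (gM 0%N).
have M1 : 0 < 2 * M + 1 by rewrite ltr_wpDl // mulr_ge0.
have [t t0 Ht] := qs_small (divr_gt0 u0 M1).
have [n nt] : exists n : nat, t^-1 < n%:R.
  exists (Num.bound t^-1).
  by apply: archi_boundP; rewrite invr_ge0 ltW.
have := limit_qs Ht (a := s + d) (c := s + n%:R * d) (z := s).
rewrite !opprD !addrA !subrr !add0r !normrN normrM.
have nd0 : 0 < `|d| by rewrite normr_gt0.
have -> : `|d| < t * (`|n%:R| * `|d|).
  rewrite mulrA ltr_pMl // normr_nat mulrC -ltr_pdivrMr // mul1r //.
move=> /(_ isT).
have h2 : nrm (g (s + n%:R * d) - g s) <= 2 * M.
  have := gM 0%N; rewrite mul0r addr0 => h0.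
  by apply: le_trans (ler_normB _ _) _; have := gM n; lra.
rewrite mulrAC ler_pdivlMr // ler_pM2l // => h3.
lra.
Qed.

Lemma limit_bound s : nrm (g s) <= `|s|.
Proof.
rewrite -[`|s|]mulr1 -limit1.
apply: (equidistant_linear_bound limit_equid limit_inj limit_unbounded limit0).
(* Ratio 2 rather than 1, since [limit_qs] asks for a strict inequality and [u] may be 1. *)
have [K K0 HK] := qs_bounded 2; exists K => // u /andP[u0 u1].
have := limit_qs HK (a := u) (c := 1) (z := 0).
rewrite !sub0r !normrN normr1 limit0 !subr0 limit1 !mulr1; apply.
by rewrite ger0_norm // (le_lt_trans u1) // ltr1n.
Qed.

End Limit.

(** The coordinates of [a n] converge to some [s] with |s| <= t. Then |g s| <= t by [limit_bound],
    but the failure of symmetry survives as |g s| >= (1 + e) t. *)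
Lemma blow_up_contradiction (a : nat -> R) t e : 0 < t -> 0 < e ->
  (forall n, D (x n) (a n) <= t * D (x n) (b n)) ->
  ~ (forall n, (1 + e) * t * E (b n) (x n) < E (a n) (x n)).
Proof.
move=> t0 e0 at_ na; have [g gP] := limit_exists.
have sa n : `|sigma a n| <= t by rewrite norm_sigma ler_pdivrMr.
have [s as_] : exists s : R, sigma a @ U --> s.
  by apply: (@ultra_bounded_cvg R _ U FU _ t); apply: nearW.
have st : `|s| <= t.
  by apply: (ler_cvg_to (cvg_norm as_) (cvg_cst _)); apply: nearW.
have : (1 + e) * t <= nrm (g s).
  apply: (ler_cvg_to (cvg_cst _) (cvg_norm (gP _ _ as_))); apply: nearW => n.
  by rewrite norm_G ler_pdivlMr // ltW // na.
by have := limit_bound gP s => h1 h2; nra.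
Qed.

End Sequence.

(** If no [delta] works, the values 1/(n+1) yield bad triples, packed as [(a, b, x)]; an ultrafilter
    finer than [\oo] makes their scales tend to 0. *)
Lemma asymptotically_symmetric_param t e : 0 < t -> 0 < e ->
  exists2 delta : R, 0 < delta & forall a b x, b != x -> D x b <= delta ->
    D x a <= t * D x b -> E a x <= (1 + e) * t * E b x.
Proof.
move=> t0 e0; apply: contrapT => H.
have bad n : exists y : R * R * R, [/\ y.1.2 != y.2,
    D y.2 y.1.2 <= n.+1%:R^-1, D y.2 y.1.1 <= t * D y.2 y.1.2 &
    (1 + e) * t * E y.1.2 y.2 < E y.1.1 y.2].
  apply: contrapT => H'; apply: H; exists n.+1%:R^-1; first by rewrite invr_gt0.
  move=> a b x bx xb xa; rewrite leNgt; apply/negP => lt.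
  by apply: H'; exists (a, b, x).
have [y Hy] := choice bad.
have [U [FU sU]] := @ultraFilterLemma nat \oo _.
apply: (@blow_up_contradiction U (fun n => (y n).2) (fun n => (y n).1.2) FU _ _
  (fun n => (y n).1.1) t e) => //.
- by move=> n; case: (Hy n).
- move=> r r0; apply: sU.
  near=> n; have [_ + _ _] := Hy n; move=> /le_trans; apply.
  by apply: ltW; near: n; exact: (near_infty_natSinv_lt (PosNum r0)).
- by move=> n; case: (Hy n).
- by move=> n; case: (Hy n).
Unshelve. all: by end_near. Qed.

End BlowUp.

(** * Quasisymmetric embeddings and quasilines *)

(** [omega] and [Heq] are suprema over all scales up to [r], so one good radius is enough. *)
Lemma right_cvg_le (R : realType) (f : R -> \bar R) (l e : R) :
  f r @[r --> 0^'+] --> l%:E -> 0 < e ->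
  exists2 r : R, 0 < r & (f r <= (l + e)%:E)%E.
Proof.
move=> /fine_cvgP[fin cv] e0.
have lt : \forall r \near 0^'+, fine (f r) < l + e.
  by apply: (cvgr_lt _ cv); rewrite ltrDl.
have [r [[r0 fr] frl]] := filter_ex (filterI (filterI (nbhs_right_gt 0) fin) lt).
by exists r => //; rewrite -(fineK fr) lee_fin ltW.
Qed.

(** The point is to exclude [t = 0]. With [eta 0 = e], an increasing [eta] would miss 0 and a
    decreasing one would miss [e + 1]. *)
Lemma homeomorphism_itv_eq (R : realType) (eta : R -> R) (e : R) :
  homeomorphism (`[0, +oo[ : set R) (`[0, +oo[ : set R) eta -> 0 < e ->
  exists2 t : R, 0 < t & eta t = e.
Proof.
case=> -[fun_eta inj_eta surj_eta] cont _ e0.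
have ge0E (t : R) : (t \in `[0, +oo[) = (0 <= t) by rewrite in_itv /= andbT.
have surj (y : R) : 0 <= y -> exists2 t : R, 0 <= t & eta t = y.
  move=> y0; have [|t /= + <-] := surj_eta y; first by rewrite /= ge0E.
  by rewrite ge0E => t0; exists t.
have [t t0 te] := surj _ (ltW e0).
have [t00|tn0] := eqVneq t 0; last by exists t => //; rewrite lt_neqAle eq_sym tn0.
rewrite t00 in te.
have etage0 (s : R) : 0 <= s -> 0 <= eta s.
  by move=> s0; have := fun_eta s; rewrite /= !ge0E => /(_ s0).
have inj : {in `[0, +oo[ &, injective eta}.
  by move=> a b a0 b0; apply: inj_eta; rewrite inE.
have [inc|dec] := itv_continuous_inj_mono cont inj.
  have [c c0 ec] := surj _ (lexx 0).
  have cp : 0 < c.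
    rewrite lt_neqAle c0 andbT; apply/eqP => c00.
    by move: ec e0; rewrite -c00 te => ->; rewrite ltxx.
  have := inc 0 c; rewrite !ge0E lexx c0 => /(_ isT isT cp).
  by rewrite ec te ltNge (ltW e0).
have [c c0 ec] := surj (e + 1) (addr_ge0 (ltW e0) ler01).
have cp : 0 < c.
  rewrite lt_neqAle c0 andbT; apply/eqP => c00.
  by move: ec; rewrite -c00 te; lra.
have := dec c 0; rewrite !ge0E lexx c0 => /(_ isT isT cp).
by rewrite ec te; lra.
Qed.

(** * The three-point condition in product form *)

Section Quasisymmetric.
Variables (R : realType) (X Y : metricType R) (A : set X) (h : X -> Y).
Hypothesis qs : qs_embedding A h.

Lemma qs_inj a b : A a -> A b -> h a = h b -> a = b.
Proof. by case: qs => -[[_ inj _] _ _] _ Aa Ab; apply: inj; rewrite inE. Qed.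

Lemma qs_mdist_gt0 a b : A a -> A b -> a != b -> 0 < mdist (h a) (h b).
Proof.
move=> Aa Ab; rewrite mdist_gt0; apply: contra => /eqP hab.
by apply/eqP; exact: qs_inj.
Qed.

Lemma qs_embedding_bounded (t : R) : exists2 K : R, 0 <= K &
  forall a b x, A a -> A b -> A x -> mdist a x <= t * mdist b x ->
    mdist (h a) (h x) <= K * mdist (h b) (h x).
Proof.
have [_ [eta [_ Heta]]] := qs.
(* The 1 covers [a = b], which the three-point condition leaves out; the absolute value allows
   negative [t]. *)
exists (Num.max (eta `|t|) 1); first by rewrite le_max ler01 orbT.
move=> a b x Aa Ab Ax abx.
have K1 : 1 <= Num.max (eta `|t|) 1 by rewrite le_max lexx orbT.
have [->|ax] := eqVneq a x.
  by rewrite mdistxx mulr_ge0 ?mdist_ge0 // (le_trans ler01).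
have [bx|bx] := eqVneq b x.
  move: abx; rewrite bx mdistxx mulr0 leNgt mdist_gt0 ax; by [].
have [->|ab] := eqVneq a b; first by rewrite ler_peMl // mdist_ge0.
have bx0 : 0 < mdist b x by rewrite mdist_gt0.
have := Heta a b x Aa Ab Ax ab ax bx `|t| (normr_ge0 _).
rewrite ler_pdivrMr // => H.
have {}H := H (le_trans abx (ler_wpM2r (ltW bx0) (ler_norm _))).
rewrite -ler_pdivrMr ?qs_mdist_gt0 //; apply: le_trans H _.
by rewrite le_max lexx.
Qed.

Lemma qs_embedding_small (e : R) : 0 < e -> exists2 t : R, 0 < t &
  forall a b x, A a -> A b -> A x -> mdist a x <= t * mdist b x ->
    mdist (h a) (h x) <= e * mdist (h b) (h x).
Proof.
have [_ [eta [/homeomorphism_itv_eq He Heta]]] := qs.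
move=> e0; have [t t0 te] := He _ e0.
(* The bound 1/2 excludes [a = b]. *)
exists (Num.min t (1 / 2)); first by rewrite lt_min t0 divr_gt0.
move=> a b x Aa Ab Ax.
have [->|ax] := eqVneq a x.
  by move=> _; rewrite mdistxx mulr_ge0 ?mdist_ge0 // ltW.
have ax0 : 0 < mdist a x by rewrite mdist_gt0.
have [->|bx] := eqVneq b x.
  by rewrite mdistxx mulr0 leNgt ax0.
have bx0 : 0 < mdist b x by rewrite mdist_gt0.
have m1 : Num.min t (1 / 2) <= t by rewrite ge_min lexx.
have m2 : Num.min t (1 / 2) <= 1 / 2 by rewrite ge_min lexx orbT.
have [->|ab] := eqVneq a b; first by move=> H; nra.
move=> H; rewrite -ler_pdivrMr ?qs_mdist_gt0 // -te.
apply: Heta => //; first exact: ltW.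
by rewrite ler_pdivrMr //; nra.
Qed.

End Quasisymmetric.

(** * Diameters of triples *)

Section Diameter.
Variables (R : realType) (X : metricType R).
Implicit Types a b x : X.

Lemma diam3_ge a b x :
  ((mdist a x)%:E <= diam [set a; b; x])%E /\
  ((mdist b x)%:E <= diam [set a; b; x])%E.
Proof.
split; apply: ereal_sup_ubound.
  by exists (a, x) => //; split; [left; left | right].
by exists (b, x) => //; split; [left; right | right].
Qed.

Lemma diam3_le a b x (r : R) :
  mdist a x <= r -> mdist b x <= r -> (diam [set a; b; x] <= (2 * r)%:E)%E.
Proof.
move=> ar br; have xr y : [set a; b; x] y -> mdist y x <= r.
  case=> [[->|->]|->] //; rewrite mdistxx.
  by apply: le_trans ar; exact: mdist_ge0.
apply: ge_ereal_sup => _ [[y z] [/= /xr yr /xr zr] <-]; rewrite lee_fin.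
by have := metric_triangle y x z; rewrite [mdist x z]metric_sym; lra.
Qed.

End Diameter.

(** * Comparison of EWAS and WAS *)

Section Symmetry.
Variables (R : realType) (X Y : metricType R) (A : set X) (h : X -> Y).
Hypothesis qs : qs_embedding A h.

Lemma EWAS_equidistant e : EWAS A h -> 0 < e ->
  exists2 r : R, 0 < r & forall a b x, A a -> A b -> A x ->
    mdist a x = mdist b x -> mdist b x <= r ->
    mdist (h a) (h x) <= (1 + e) * mdist (h b) (h x).
Proof.
move=> ew e0; have [r r0 Hr] := right_cvg_le ew e0.
(* Two points within [r / 2] of [x] span a diameter of at most [r]. *)
exists (r / 2); first by rewrite divr_gt0.
move=> a b x Aa Ab Ax abx bxr.
have [ax|ax] := eqVneq a x.
  rewrite ax mdistxx mulr_ge0 ?mdist_ge0 //; lra.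
have ax0 : 0 < mdist a x by rewrite mdist_gt0.
have bx : b != x by rewrite -mdist_gt0 -abx.
rewrite -ler_pdivrMr ?(qs_mdist_gt0 qs) // -lee_fin.
apply: le_trans Hr; apply: le_trans (ereal_sup_ubound _); last first.
  exists a, b, x; split => //; apply/andP; split.
    by apply: lt_le_trans (diam3_ge a b x).1; rewrite lte_fin.
  have -> : r = 2 * (r / 2) by field.
  by apply: diam3_le; rewrite ?abx.
by rewrite lee_fin le_max lexx.
Qed.

(** For equal distances WAS applies in both orders and bounds the maximum by [1 + e]. The lower
    bound 1 comes from degenerate triples [a, a, x], which exist at every scale by
    non-discreteness. *)
Lemma WAS_EWAS : (forall r : R, 0 < r ->
    exists a x, [/\ A a, A x, a != x & mdist a x <= r]) ->
  WAS A h -> EWAS A h.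
Proof.
move=> nondiscrete was.
have Heq1 (r : R) : 0 < r -> (1%:E <= Heq A h r)%E.
  move=> r0; have r20 : 0 < r / 2 by rewrite divr_gt0.
  have [a [x [Aa Ax ax axr]]] := nondiscrete _ r20.
  apply: ereal_sup_ubound; exists a, a, x; split => //.
    apply/andP; split.
      by apply: lt_le_trans (diam3_ge a a x).1; rewrite lte_fin mdist_gt0.
    have -> : r = 2 * (r / 2) by field.
    exact: diam3_le.
  by rewrite divff ?maxxx // gt_eqF // (qs_mdist_gt0 qs).
have HeqE (e : R) : 0 < e -> \forall r \near 0^'+, (Heq A h r <= (1 + e)%:E)%E.
  move=> e0; have [d d0 Hd] := was e e0.
  near=> r.
  have rd : r <= d by near: r; exact: nbhs_right_le.
  apply: ge_ereal_sup => _ [a [b [x [[Aa [Ab Ax]] abx /andP[d1 d2] ->]]]].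
  have dd : (diam [set a; b; x] <= d%:E)%E by apply: le_trans d2 _; rewrite lee_fin.
  have bx : b != x.
    apply: contraTneq d1 => bx; rewrite -leNgt.
    have := @diam3_le _ _ a b x 0; rewrite mulr0 abx bx mdistxx; exact.
  have ax : a != x by rewrite -mdist_gt0 abx mdist_gt0.
  rewrite lee_fin ge_max.
  have [->|ab] := eqVneq a b.
    by rewrite divff ?gt_eqF ?(qs_mdist_gt0 qs) // andbb; lra.
  have dd' : (diam [set b; a; x] <= d%:E)%E by rewrite (setUC [set b]).
  have := Hd _ _ _ Aa Ab Ax ab ax bx dd.
  have := Hd _ _ _ Ab Aa Ax _ bx ax dd'.
  rewrite eq_sym ab abx divff ?gt_eqF ?mdist_gt0 // lexx mulr1.
  by move=> /(_ isT isT) -> /(_ isT) ->.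
apply/fine_cvgP; split.
  near=> r; rewrite fin_numE; apply/andP; split.
    rewrite gt_eqF // (lt_le_trans _ (Heq1 r _)) ?ltNyr //.
  rewrite lt_eqF // (@le_lt_trans _ _ (1 + 1)%:E) ?ltry //.
  by near: r; exact: HeqE.
apply/cvgrPdist_le => e e0; near=> r.
have r0 : 0 < r by [].
have lo := Heq1 r r0.
have hi : (Heq A h r <= (1 + e)%:E)%E by near: r; exact: HeqE.
have fin : Heq A h r \is a fin_num.
  rewrite fin_numE gt_eqF ?(lt_le_trans _ lo) ?ltNyr //=.
  by rewrite lt_eqF // (le_lt_trans hi) ?ltry.
rewrite /= distrC ler_norml; move: lo hi.
by rewrite -(fineK fin) !lee_fin => lo hi; apply/andP; split; lra.
Unshelve. all: by end_near. Qed.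

End Symmetry.

(** * Geometry of a parametrised quasiline *)

Section Quasiline.
Variables (R : realType) (f : R^o -> Rcomplex R).
Hypothesis qf : qs_embedding setT f.
Local Notation D s u := (mdist (f s) (f u)).

Let f_inj : injective f.
Proof. by move=> a b; apply: (qs_inj qf). Qed.

Let f_continuous : continuous f.
Proof. by case: qf => -[_ cf _] _; apply/continuous_subspace_setT. Qed.

(** A quasiline is unbounded in both directions: with [t] taken from [qs_embedding_small] for the
    ratio [D (u + d) u / r], the point at [N = t^-1] steps is at distance at least [r]. *)
Let far_point (u d r : R) : d != 0 -> 0 < r ->
  exists2 N : R, 0 < N & r <= D u (u + N * d).
Proof.
move=> d0 r0.
have c0 : 0 < D (u + d) u.
  by rewrite mdist_gt0 (inj_eq f_inj) -subr_eq0 addrAC subrr add0r.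
have [t t0 Ht] := qs_embedding_small qf (divr_gt0 c0 r0).
exists t^-1; first by rewrite invr_gt0.
have := Ht (u + d) (u + t^-1 * d) u I I I.
have mE (z : R) : mdist (u + z : R^o) u = `|z|.
  by rewrite -[LHS]/(`|u - (u + z)|) opprD addrA subrr add0r normrN.
rewrite !mE normrM (gtr0_norm (_ : 0 < t^-1)) ?invr_gt0 // mulrA divff ?gt_eqF //.
rewrite mul1r lexx => /(_ isT); rewrite mulrAC ler_pdivlMr // ler_pM2l //.
by rewrite metric_sym.
Qed.

Let dist_continuous (u : R) : continuous (fun s : R => D u s).
Proof.
move=> s; apply: (@cvg_norm _ (Rcomplex R) _ (nbhs s) _ (fun s => f s - f u)).
by apply: cvgB; [exact: f_continuous | exact: cvg_cst].
Qed.

Lemma quasiline_right (u r : R) : 0 < r -> exists2 s : R, u < s & D u s = r.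
Proof.
move=> r0; have [N N0 rN] := @far_point u 1 r (oner_neq0 _) r0.
rewrite mulr1 in rN.
have uN : u <= u + N by rewrite lerDl ltW.
have [|c] := @IVT R (fun s => D u s) u (u + N) r uN
    (continuous_subspaceT (dist_continuous (u := u))).
  by rewrite mdistxx minEle mdist_ge0 maxEle mdist_ge0 (ltW r0).
rewrite in_itv /= => /andP[uc _] Dc; exists c => //.
rewrite lt_neqAle uc andbT; apply: contraTneq r0 => ucE.
by rewrite -Dc ucE mdistxx ltxx.
Qed.

Lemma quasiline_left (u r : R) : 0 < r -> exists2 s : R, s < u & D u s = r.
Proof.
move=> r0; have N1 : -1 != 0 :> R by rewrite oppr_eq0 oner_neq0.
have [N N0 rN] := far_point u N1 r0; rewrite mulrN1 in rN.
have uN : u - N <= u by rewrite gerBl ltW.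
have [|c] := @IVT R (fun s => D u s) (u - N) u r uN
    (continuous_subspaceT (dist_continuous (u := u))).
  by rewrite mdistxx minC maxC minEle mdist_ge0 maxEle mdist_ge0 (ltW r0).
rewrite in_itv /= => /andP[_ uc] Dc; exists c => //.
rewrite lt_neqAle uc andbT; apply: contraTneq r0 => ucE.
by rewrite -Dc ucE mdistxx ltxx.
Qed.

Lemma quasiline_subarc (u w v : R) : u <= w -> w <= v -> u < v ->
  subarc (f @` setT) (f u) (f v) (f w).
Proof.
move=> uw wv uv; exists (fun t : R => f (u + t * (v - u))).
have vu0 : 0 < v - u by rewrite subr_gt0.
split.
- apply: continuous_subspaceT => t; apply: continuous_comp; last exact: f_continuous.
  by apply: cvgD; [exact: cvg_cst | apply: cvgM; [exact: cvg_id | exact: cvg_cst]].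
- move=> s t _ _ /f_inj /addrI /mulIf; apply; exact: lt0r_neq0.
- by rewrite mul0r addr0 mul1r addrC subrK.
- by move=> _ [t _ <-]; exists (u + t * (v - u)).
- exists ((w - u) / (v - u)) => /=.
    rewrite in_itv /= ler_pdivrMr // mul1r lerD2r wv andbT.
    by apply: divr_ge0; rewrite ?subr_ge0 // ltW.
  by rewrite mulfVK ?gt_eqF // addrC subrK.
Qed.

Lemma quasiline_conformal (e : R) : asymptotically_conformal (f @` setT) ->
  0 < e -> exists2 r : R, 0 < r & forall u w v : R, u <= w -> w <= v ->
    D u v <= r -> D u w + D w v <= (1 + e) * D u v.
Proof.
move=> ac e0; have [r r0 Hr] := right_cvg_le ac e0.
exists r => // u w v uw wv Duv.
have [uv|vu] := ltP u v; last first.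
  have vE : v = u by apply: le_anti; rewrite vu (le_trans uw wv).
  have wE : w = u by apply: le_anti; rewrite uw (le_trans wv vu).
  by rewrite vE wE !mdistxx addr0 mulr0.
have D0 : 0 < D u v by rewrite mdist_gt0 (inj_eq f_inj) lt_eqF.
have : (((D u w + D w v) / D u v - 1)%:E <= (0 + e)%:E)%E.
  apply: le_trans Hr; apply: le_trans (ereal_sup_ubound _); last first.
    exists (f u, f v) => /=; last by reflexivity.
    by split; [exists u | exists v | rewrite D0].
  apply: ereal_sup_ubound; exists (f w) => //.
  exact: quasiline_subarc.
by rewrite lee_fin add0r lerBlDr ler_pdivrMr // [e + 1]addrC.
Qed.

End Quasiline.

(** * Transfer to quasilines through a parametrisation *)

Theorem theorem1p3 (R : realType) (Gamma1 Gamma2 : set (Rcomplex R))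
    (hGamma1 : quasiline Gamma1) (hGamma2 : quasiline Gamma2)
    (hconf : asymptotically_conformal Gamma1)
    (h : Rcomplex R -> Rcomplex R)
    (hh : qs_homeomorphism Gamma1 Gamma2 h) :
  (EWAS Gamma1 h -> AS Gamma1 h) /\
  ((EWAS Gamma1 h <-> WAS Gamma1 h) /\ (WAS Gamma1 h <-> AS Gamma1 h)).
Proof.
have [f [qf fE]] := hGamma1; have [_ qh] := hh.
have Gf s : Gamma1 (f s) by rewrite -fE; exists s.
have AS_WAS : AS Gamma1 h -> WAS Gamma1 h by move=> as_; exact: as_ ltr01.
have was_ewas : WAS Gamma1 h -> EWAS Gamma1 h.
  apply: WAS_EWAS => // r r0.
  have [s s0 sr] := quasiline_right qf 0 r0.
  exists (f 0), (f s); split => //; last by rewrite sr.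
  by rewrite -mdist_gt0 sr.
(* This closes the cycle AS, WAS, EWAS. *)
suff EWAS_AS : EWAS Gamma1 h -> AS Gamma1 h by tauto.
move=> ew t t0 e e0.
have f_inj : injective f by move=> a b; apply: (qs_inj qf).
have hf_inj : injective (h \o f).
  by move=> a b /(qs_inj qh (Gf a) (Gf b)) /f_inj.
have conf (e' : R) : 0 < e' -> exists2 r : R, 0 < r & forall u w v : R,
    u <= w -> w <= v -> mdist (f u) (f v) <= r ->
    mdist (f u) (f w) + mdist (f w) (f v) <= (1 + e') * mdist (f u) (f v).
  by apply: (quasiline_conformal qf); rewrite fE.
have bounded (K : R) : exists2 K' : R, 0 <= K' & forall a b x : R,
    mdist (f x) (f a) <= K * mdist (f x) (f b) ->
    nrm (h (f a) - h (f x)) <= K' * nrm (h (f b) - h (f x)).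
  have [K' K0 HK] := qs_embedding_bounded qh K; exists K' => // a b x.
  rewrite [mdist (f x) (f a)]metric_sym [mdist (f x) (f b)]metric_sym.
  move=> /(HK _ _ _ (Gf a) (Gf b) (Gf x)).
  by rewrite -!(distrC (h (f x))).
have small (e' : R) : 0 < e' -> exists2 t' : R, 0 < t' & forall a b x : R,
    mdist (f x) (f a) <= t' * mdist (f x) (f b) ->
    nrm (h (f a) - h (f x)) <= e' * nrm (h (f b) - h (f x)).
  move=> e'0; have [t' t'0 HK] := qs_embedding_small qh e'0.
  exists t' => // a b x.
  rewrite [mdist (f x) (f a)]metric_sym [mdist (f x) (f b)]metric_sym.
  move=> /(HK _ _ _ (Gf a) (Gf b) (Gf x)).
  by rewrite -!(distrC (h (f x))).
have equid (e' : R) : 0 < e' -> exists2 r : R, 0 < r & forall a b x : R,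
    mdist (f x) (f a) = mdist (f x) (f b) -> mdist (f x) (f b) <= r ->
    nrm (h (f a) - h (f x)) <= (1 + e') * nrm (h (f b) - h (f x)).
  move=> e'0; have [r r0 Hr] := EWAS_equidistant qh ew e'0.
  exists r => // a b x.
  rewrite [mdist (f x) (f a)]metric_sym [mdist (f x) (f b)]metric_sym.
  move=> ab br; have := Hr _ _ _ (Gf a) (Gf b) (Gf x) ab br.
  by rewrite -!(distrC (h (f x))).
(* The blow-up argument runs on the line, with [p = f] and [F = h \o f]. *)
have [d d0 Hd] := asymptotically_symmetric_param f_inj hf_inj conf
  (quasiline_right qf) (quasiline_left qf) bounded small equid t0 e0.
exists d => // a b x; rewrite -fE => -[a' _ <-] [b' _ <-] [x' _ <-].
move=> ab ax bx dd abx.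
have bx0 : 0 < mdist (f b') (f x') by rewrite mdist_gt0.
have hbx0 : 0 < mdist (h (f b')) (h (f x')) by apply: (qs_mdist_gt0 qh).
rewrite ler_pdivrMr //.
have bd : mdist (f b') (f x') <= d.
  by rewrite -lee_fin; apply: le_trans (diam3_ge _ _ _).2 dd.
have := Hd a' b' x'; rewrite -(inj_eq f_inj) bx.
rewrite [mdist (f x') (f b')]metric_sym bd [mdist (f x') (f a')]metric_sym.
have -> : mdist (f a') (f x') <= t * mdist (f b') (f x')
  by rewrite -ler_pdivrMr.
move=> /(_ isT isT isT).
by rewrite -!(distrC (h (f x'))).
Qed.
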